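(* For every positive integer $n$ there is a finite completely regular monoid $M$ such that every finite graph $G$ with $\mathrm{End}(G)\cong M$ contains a subdivision of $K_{n,n}$. In particular, no class of graphs excluding a (fixed) topological minor is $\mathrm{End}$-universal for completely regular monoids.
   Context: A semigroup is completely regular if it is a union of subgroups. $\mathrm{End}(G)$ is the monoid under composition of endomorphisms of the undirected graph $G$ (vertex maps sending edges to edges). A class of graphs $\mathcal G$ is $\mathrm{End}$-universal for a class of monoids $\mathcal M$ if every $M\in\mathcal M$ is isomorphic to $\mathrm{End}(G)$ for some $G\in\mathcal G$. A class excludes a topological minor if there is a graph $H$ no subdivision of which is a subgraph of a graph in the class. All graphs and monoids are finite. *)

(* Defs.v *)
From HB Require Import structures.
From mathcomp Require Import all_boot.

Set Implicit Arguments.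
Unset Strict Implicit.
Unset Printing Implicit Defensive.

#[short(type="finMonoidType")]
HB.structure Definition FinMonoid := {M of Monoid M & Finite M}.

Definition monoid_isomorphic (M N : monoidType) : Prop :=
  exists2 f : M -> N, bijective f & monoid_morphism f.

(* The identity [e] of a subgroup need not be the identity of [M]. *)
Definition is_subgroup (M : finMonoidType) (A : {set M}) : Prop :=
  mulg_closed A /\
  exists2 e, e \in A &
    forall x, x \in A ->
      [/\ (e * x)%g = x, (x * e)%g = x &
          exists2 y, y \in A & (x * y)%g = e /\ (y * x)%g = e].

Definition completely_regular (M : finMonoidType) : Prop :=
  exists2 F : {set {set M}},
    (forall A, A \in F -> is_subgroup A) & cover F = [set: M].

(* Finite simple graphs; the graph with no vertex is allowed. *)
Record graph := Graph {
  vertex :> finType;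
  edge : rel vertex;
  edge_sym : symmetric edge;
  edge_irr : irreflexive edge
}.

Definition is_hom (G H : graph) (f : G -> H) : bool :=
  [forall x, forall y, edge x y ==> edge (f x) (f y)].

Lemma is_homP (G H : graph) (f : G -> H) :
  reflect (forall x y, edge x y -> edge (f x) (f y)) (is_hom f).
Proof.
apply: (iffP forallP) => [h x y | h x].
  by move/forallP: (h x) => /(_ y)/implyP.
by apply/forallP => y; apply/implyP; apply: h.
Qed.

Record End (G : graph) := Endo {
  endo_fun :> {ffun G -> G};
  endo_hom : is_hom endo_fun
}.

HB.instance Definition _ (G : graph) := [isSub for @endo_fun G].
HB.instance Definition _ (G : graph) := [Finite of End G by <:].

Section EndMonoid.
Variable G : graph.
Implicit Types f g : End G.

Fact endo_id_hom : is_hom [ffun x : G => x].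
Proof. by apply/is_homP => x y; rewrite !ffunE. Qed.

Fact endo_comp_hom f g : is_hom [ffun x => f (g x)].
Proof.
apply/is_homP => x y exy; rewrite !ffunE.
by apply: (is_homP _ (endo_hom f)); apply: (is_homP _ (endo_hom g)).
Qed.

Definition endo_id : End G := Endo endo_id_hom.
Definition endo_comp f g : End G := Endo (endo_comp_hom f g).

Fact endo_compA : associative endo_comp.
Proof. by move=> f g h; apply/val_inj/ffunP => x; rewrite !ffunE. Qed.

Fact endo_comp1f : left_id endo_id endo_comp.
Proof. by move=> f; apply/val_inj/ffunP => x; rewrite !ffunE. Qed.

Fact endo_compf1 : right_id endo_id endo_comp.
Proof. by move=> f; apply/val_inj/ffunP => x; rewrite !ffunE. Qed.

HB.instance Definition _ := isSemigroup.Build (End G) endo_compA.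
HB.instance Definition _ :=
  Semigroup_isMonoid.Build (End G) endo_comp1f endo_compf1.
End EndMonoid.

(* Up to isomorphism, [H] is a (not necessarily induced) subgraph of [G]. *)
Definition is_subgraph (H G : graph) : Prop :=
  exists2 f : H -> G, injective f & is_hom f.

Section SubdivideEdge.
Variables (G : graph) (u v : G).

(* [None] is the new vertex, placed in the middle of the edge [uv]. *)
Definition subdivide_rel : rel (option G) := fun x y =>
  match x, y with
  | Some a, Some b =>
      edge a b && ~~ ((a == u) && (b == v) || (a == v) && (b == u))
  | Some a, None | None, Some a => (a == u) || (a == v)
  | None, None => false
  end.

Fact subdivide_sym : symmetric subdivide_rel.
Proof.
move=> [a|] [b|] //=; rewrite edge_sym; congr (_ && ~~ _).
by rewrite orbC; congr (_ || _); rewrite andbC.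
Qed.

Fact subdivide_irr : irreflexive subdivide_rel.
Proof. by move=> [a|] //=; rewrite edge_irr. Qed.

Definition subdivide_edge : graph := Graph subdivide_sym subdivide_irr.
End SubdivideEdge.

Inductive subdivision (H : graph) : graph -> Prop :=
| subdivision_refl : subdivision H H
| subdivision_step (K : graph) (u v : K) :
    subdivision H K -> edge u v -> subdivision H (subdivide_edge u v).

Definition contains_subdivision (H G : graph) : Prop :=
  exists2 K, subdivision H K & is_subgraph K G.

Section CompleteBipartite.
Variables m n : nat.

Definition biclique_rel : rel ('I_m + 'I_n)%type := fun x y =>
  match x, y with
  | inl _, inr _ | inr _, inl _ => true
  | _, _ => false
  end.

Fact biclique_sym : symmetric biclique_rel.
Proof. by move=> [a|a] [b|b]. Qed.

Fact biclique_irr : irreflexive biclique_rel.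
Proof. by move=> [a|a]. Qed.

Definition biclique : graph := Graph biclique_sym biclique_irr.
End CompleteBipartite.

Definition End_universal (C : graph -> Prop) (P : finMonoidType -> Prop) :=
  forall M : finMonoidType, P M ->
    exists2 G : graph, C G & monoid_isomorphic M (End G).

Definition excludes_topological_minor (C : graph -> Prop) : Prop :=
  exists H : graph, forall G, C G -> ~ contains_subdivision H G.

(* Main.v *)
(** Fix a finite set T with at least six elements, and let M consist of Sym(T),
    idempotents f_xy for x <> y, and left zeros g_x, h_y, acting on two copies
    of T: Sym(T) acts diagonally, f_xy is constantly x on the first copy and y
    on the second, g_x and h_y are constant on the union. Let End(G) = M and
    consider how f_xy(v) depends on (x, y) for a vertex v. By multiple
    transitivity, if it depends on both x and y then it determines both, at
    least on pairs (x, y) from A x B with A, B disjoint. The image of g_x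
    consists of vertices depending on x only (at most), that of h_y of vertices
    depending on y only. A path between the two kinds must exist within the
    non-constant vertices of the image of a fixed f, for otherwise f_xy and f_yx
    could be glued to an endomorphism that is not in M. Shortened, such a path
    starts at a vertex depending on x only, ends at one depending on y only,
    and its interior vertices depend on both; its images under the f_xy form a
    subdivided complete bipartite graph on A and B. For B = H x H and A = H this
    yields a subdivision of H, with hubs A and the edge (a, b) going through
    (a, b) in B. *)

Require Import Defs.
From HB Require Import structures.
From mathcomp Require Import all_boot all_fingroup.

Set Implicit Arguments.
Unset Strict Implicit.
Unset Printing Implicit Defensive.

(** * Subdivisions from systems of disjoint paths *)

Section Subdivisions.
Variables H G : graph.

(* [L] lists the edges of [K] still to be replaced by paths, with the interior
   vertices of these paths; entries that are not edges are ignored, so that no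
   bookkeeping of orientations and repetitions is needed. *)
Lemma path_system_subdivision (K : graph) (phi : K -> G)
    (L : seq (K * K * seq G)) :
  subdivision H K -> injective phi ->
  uniq (flatten [seq t.2 | t <- L]) ->
  (forall a, phi a \notin flatten [seq t.2 | t <- L]) ->
  (forall t, t \in L -> path (@edge G) (phi t.1.1) (rcons t.2 (phi t.1.2))) ->
  (forall a b, edge a b -> edge (phi a) (phi b) \/
     exists s, (a, b, s) \in L \/ (b, a, s) \in L) ->
  contains_subdivision H G.
Proof.
(* The successor makes the measure drop also when an entry without interior vertices is
   discarded. *)
have [k] := ubnP (sumn [seq (size t.2).+1 | t <- L]).
elim: k => // k IHk in K phi L *.
case: L => [|[[u v] s] L] ltk sHK phiI uL phiL pL eL.
  exists K => //; exists phi => //; apply/is_homP => a b /eL[//|[s]].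
  by rewrite !in_nil => -[].
have pL' t : t \in L -> path (@edge G) (phi t.1.1) (rcons t.2 (phi t.1.2)).
  by move=> tL; apply: pL; rewrite inE tL orbT.
have := pL (u, v, s); rewrite mem_head => /(_ isT).
move: ltk uL phiL; rewrite /= ltnS.
case: s => [|w s] /= in pL eL * => ltk.
  move=> uL phiL /andP[euv _].
  apply: (IHk K phi L) => //; try exact: leq_trans ltk.
  move=> a b /eL[|[s]]; first by left.
  rewrite !inE => -[] /orP[/eqP[-> -> _]| sL]; try (by right; exists s; auto).
    by left.
  by left; rewrite edge_sym.
rewrite mem_cat negb_or cat_uniq => /and3P[/andP[wNs wNL] us /andP[sNL uL]].
move=> phiL /andP[euw pwv].
have phiL2 a : phi a \notin flatten [seq t.2 | t <- L].
  by have := phiL a; rewrite inE mem_cat !negb_or => /and3P[].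
have [Euv|NEuv] := boolP (edge u v); last first.
  apply: (IHk K phi L) => //.
    by apply: leq_trans ltk; rewrite addSn ltnS leq_addl.
  move=> a b eab; have [|[t]] := eL a b eab; first by left.
  rewrite !inE => -[] /orP[/eqP[aE bE _]| tL]; try (by right; exists t; auto).
    by rewrite -aE -bE eab in NEuv.
  by rewrite -aE -bE edge_sym eab in NEuv.
(* The new vertex goes to the first interior vertex [w]; the rest [s] of the path is left for the
   edge from [None] to [Some v]. *)
pose psi (x : subdivide_edge u v) : G := if x is Some a then phi a else w.
pose up (t : K * K * seq G) : subdivide_edge u v * subdivide_edge u v * seq G :=
  (Some t.1.1, Some t.1.2, t.2).
have upL : [seq t.2 | t <- map up L] = [seq t.2 | t <- L].
  by rewrite -map_comp.
apply: (IHk (subdivide_edge u v) psi ((None, Some v, s) :: map up L)) => /=.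
- by rewrite -map_comp.
- exact: subdivision_step.
- move=> [a|] [b|] //=; first by move=> /phiI ->.
    by move=> aw; have := phiL a; rewrite aw mem_head.
  by move=> aw; have := phiL b; rewrite -aw mem_head.
- by rewrite upL cat_uniq us sNL.
- move=> [a|]; rewrite upL mem_cat /=.
    by have := phiL a; rewrite inE mem_cat !negb_or => /and3P[_ -> ->].
  by rewrite negb_or wNs.
- move=> t; rewrite inE => /orP[/eqP -> //|/mapP[t' t'L ->]].
  exact: (pL' t').
  move=> [a|] [b|] //=.
  + case/andP=> eab Nuv; have [|[t]] := eL a b eab; first by left.
    rewrite !inE => -[] /orP[/eqP[aE bE _]| tL].
    * by rewrite aE bE !eqxx in Nuv.
    * by right; exists t; left; rewrite inE (map_f up tL) orbT.
    * by rewrite aE bE !eqxx orbT in Nuv.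
    * by right; exists t; right; rewrite inE (map_f up tL) orbT.
  + case/orP=> /eqP ->; first by left.
    by right; exists s; right; rewrite mem_head.
  + case/orP=> /eqP ->; first by left; rewrite edge_sym.
    by right; exists s; left; rewrite mem_head.
Qed.

End Subdivisions.

(** * Auxiliary facts on permutations and sequences *)

Lemma perm_extending (T : finType) (s t : seq T) :
  uniq s -> uniq t -> size s = size t -> exists p : {perm T}, map p s = t.
Proof.
elim: s t => [|x s IHs] [|y t] //=; first by exists 1%g.
move=> /andP[xs us] /andP[yt ut] [/IHs[]// p pst].
exists (p * tperm (p x) y)%g; rewrite permM tpermL -pst; congr (_ :: _).
apply/eq_in_map => z zs; rewrite permM tpermD //.
  by apply: contraNneq xs => /perm_inj ->.
by apply: contraNneq yt => ->; rewrite -pst map_f.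
Qed.

Lemma exists_notin (T : finType) (s : seq T) :
  size s < #|T| -> exists x, x \notin s.
Proof.
move=> lt_sT; apply/existsP; rewrite -negb_forall.
apply: contraTN lt_sT => /forallP all_s; rewrite -leqNgt.
apply: leq_trans (card_size s); apply/subset_leq_card/subsetP => x _.
exact: all_s.
Qed.

Lemma uniq_flatten_map (I T : eqType) (S : I -> seq T) (s : seq I) :
  uniq s -> (forall i, i \in s -> uniq (S i)) ->
  (forall i j x, i \in s -> j \in s -> x \in S i -> x \in S j -> i = j) ->
  uniq (flatten (map S s)).
Proof.
elim: s => //= i s IHs /andP[is_ us] uS disj.
rewrite cat_uniq uS ?mem_head //= IHs //; first last.
- by move=> j l x js ls; apply: disj; rewrite inE ?js ?ls orbT.
- by move=> j js; rewrite uS // inE js orbT.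
rewrite andbT; apply/hasPn => x /flatten_mapP[j js xj].
apply: contra is_ => xi; rewrite (disj i j x) ?mem_head //.
by rewrite inE js orbT.
Qed.

(** * The monoid of permutations, pairs and constants *)

Section PairMonoid.
Variable T : finType.

(* The monoid acts on two copies of [T]: a permutation acts on both copies at
   once, a pair (x, y) sends the first copy to [inl x] and the second one to
   [inr y], and an element of [T + T] acts as a constant. *)
Definition distinct_pair := {z : T * T | z.1 != z.2}.

Fact move_pair_subproof (s : {perm T}) (z : distinct_pair) :
  s (val z).1 != s (val z).2.
Proof. by rewrite inj_eq ?(valP z) //; apply: perm_inj. Qed.

Definition move_pair (s : {perm T}) (z : distinct_pair) : distinct_pair :=
  exist (fun w => w.1 != w.2) (s (val z).1, s (val z).2)
    (move_pair_subproof s z).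

Definition pair_monoid := ({perm T} + distinct_pair + (T + T))%type.

HB.instance Definition _ := Finite.on pair_monoid.

Definition pair_act (m : pair_monoid) (c : T + T) : T + T :=
  match m, c with
  | inl (inl s), inl x => inl (s x)
  | inl (inl s), inr x => inr (s x)
  | inl (inr z), inl _ => inl (val z).1
  | inl (inr z), inr _ => inr (val z).2
  | inr d, _ => d
  end.

(** Composition of the actions, [m'] first; hence [t * s], as a product of permutations applies its
    left factor first. In the last case [m'] preserves both copies and [m] is constant on each. *)
Definition pair_mul (m m' : pair_monoid) : pair_monoid :=
  match m, m' with
  | _, inr c => inr (pair_act m c)
  | inl (inl s), inl (inl t) => inl (inl (t * s)%g)
  | inl (inl s), inl (inr z) => inl (inr (move_pair s z))
  | _, inl _ => m
  end.

Definition pair_one : pair_monoid := inl (inl 1%g).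

Fact pair_mulA : associative pair_mul.
Proof.
move=> [[s|z]|c] [[s'|z']|c'] [[s''|z'']|[c''|c'']] //=; rewrite ?mulgA //.
- by congr (inl (inr _)); apply: val_inj; rewrite /= !permM.
- by rewrite permM.
- by rewrite permM.
Qed.

Fact pair_mul1m : left_id pair_one pair_mul.
Proof.
move=> [[s|[[x y] z]]|[c|c]] //=; rewrite ?mulg1 ?perm1 //.
by congr (inl (inr _)); apply: val_inj; rewrite /= !perm1.
Qed.

Fact pair_mulm1 : right_id pair_one pair_mul.
Proof. by move=> [[s|z]|c] //=; rewrite ?mul1g. Qed.

HB.instance Definition _ := isSemigroup.Build pair_monoid pair_mulA.
HB.instance Definition _ :=
  Semigroup_isMonoid.Build pair_monoid pair_mul1m pair_mulm1.

(** The permutations form a subgroup, and every other element is idempotent. *)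
Lemma pair_monoid_completely_regular : completely_regular pair_monoid.
Proof.
pose U : {set pair_monoid} := [set inl (inl s) | s : {perm T}].
pose S : {set {set pair_monoid}} := [set [set m] | m in ~: U].
exists (U |: S); last first.
  apply/setP => m; rewrite inE; apply/bigcupP.
  have [mU|mU] := boolP (m \in U); first by exists U; rewrite ?setU11.
  by exists [set m]; rewrite ?set11 // setU1r // imset_f // inE.
move=> A; rewrite !inE => /orP[/eqP ->|/imsetP[m mU ->]].
  split.
    by move=> _ _ /imsetP[s _ ->] /imsetP[t _ ->]; apply: imset_f.
  exists (1%g : pair_monoid); first exact: imset_f.
  move=> _ /imsetP[s _ ->]; split; rewrite ?mul1g ?mulg1 //.
  exists (inl (inl s^-1%g)); first exact: imset_f.
  by split; congr (inl (inl _)); rewrite ?mulVg ?mulgV.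
have mm : (m * m)%g = m.
  case: m mU => [[s|z]|c] //; rewrite inE => /negP[].
  exact: imset_f.
split; first by move=> _ _ /set1P -> /set1P ->; rewrite mm set11.
exists m; rewrite ?set11 // => _ /set1P ->.
by split=> //; exists m; rewrite ?set11.
Qed.

End PairMonoid.

(** An interior vertex in [A] can replace [x], and one in [B] can replace [y], each time shortening
    the path. *)
Lemma path_between_avoiding (T : eqType) (e : rel T) (A B C : pred T) x s y :
  path e x (rcons s y) -> uniq (x :: rcons s y) -> A x -> B y ->
  all C (x :: rcons s y) ->
  exists x' s' y',
    [/\ path e x' (rcons s' y'), uniq (x' :: rcons s' y'), A x' /\ B y',
        all C (x' :: rcons s' y') & all (predC (predU A B)) s'].
Proof.
have [n] := ubnP (size s); elim: n => // n IHn in x s y *.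
rewrite ltnS => le_sn pxy uxy Ax By Cxy.
have [/hasP[a]|/hasPn notA] := boolP (has A s).
  move=> /splitPr s_a Aa.
  case: s_a le_sn pxy uxy Cxy => s1 s2 le_sn pxy uxy Cxy.
  apply: (IHn a s2 y) => //.
  - by apply: leq_trans le_sn; rewrite size_cat /= addnS ltnS leq_addl.
  - by move: pxy; rewrite rcons_cat cat_path => /andP[_ /andP[]].
  - by move: uxy; rewrite rcons_cat -cat_cons cat_uniq => /and3P[].
  - by move: Cxy; rewrite rcons_cat -cat_cons all_cat => /andP[].
have [/hasP[b]|/hasPn notB] := boolP (has B s).
  move=> /splitPr s_b Bb.
  case: s_b le_sn pxy uxy Cxy {notA} => s1 s2 le_sn pxy uxy Cxy.
  apply: (IHn x s1 b) => //.
  - by apply: leq_trans le_sn; rewrite size_cat /= addnS ltnS leq_addr.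
  - by move: pxy; rewrite rcons_cat -cat_rcons cat_path => /andP[].
  - move: uxy; rewrite rcons_cat -cat_rcons -cat_cons cat_uniq.
    by case/andP.
  - by move: Cxy; rewrite rcons_cat -cat_rcons -cat_cons all_cat => /andP[].
exists x, s, y; split=> //; apply/allP => z zs /=.
by rewrite negb_or [A z]negbTE ?notA // [B z]negbTE ?notB.
Qed.

(** * Dependence of [F z v] on the coordinates of [z] *)

Section Representation.
Variables (T : finType) (G : graph) (phi : pair_monoid T -> End G).
Hypotheses (phiM : {morph phi : m m' / (m * m')%g}) (phiI : injective phi).
Hypothesis phi_surj : forall f, exists m, phi m = f.
Hypothesis T6 : 5 < #|T|.

Implicit Types (z w : distinct_pair T) (v : G).

Local Notation F z := (phi (inl (inr z))).
Local Notation L x := (phi (inr (inl x))).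
Local Notation R y := (phi (inr (inr y))).

Lemma phi_comp m m' v : phi m (phi m' v) = phi (m * m')%g v.
Proof. by rewrite phiM ffunE. Qed.

Lemma pair_retract z w v : F z (F w v) = F z v. Proof. exact: phi_comp. Qed.

Lemma endo_edge (f : End G) u v : edge u v -> edge (f u) (f v).
Proof. by apply/is_homP; apply: endo_hom. Qed.

Lemma pair_move (s : {perm T}) z w v :
  s (val z).1 = (val w).1 -> s (val z).2 = (val w).2 ->
  phi (inl (inl s)) (F z v) = F w v.
Proof.
move=> s1 s2; have <- : move_pair s z = w; last exact: phi_comp.
by apply: val_inj; rewrite /= s1 s2 -surjective_pairing.
Qed.

Definition fst_only v :=
  [forall z, forall w, ((val z).1 == (val w).1) ==> (F z v == F w v)].
Definition snd_only v :=
  [forall z, forall w, ((val z).2 == (val w).2) ==> (F z v == F w v)].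
(** For [v] in the image of some [F z], this means that every [F w] fixes [v]. *)
Definition fixed_pt v := fst_only v && snd_only v.

Lemma fst_onlyP v :
  reflect (forall z w, (val z).1 = (val w).1 -> F z v = F w v) (fst_only v).
Proof.
apply: (iffP forallP) => h z.
  by move=> w /eqP zw; apply/eqP/(implyP (forallP (h z) w)).
by apply/forallP => w; apply/implyP => /eqP zw; apply/eqP/h.
Qed.

Lemma snd_onlyP v :
  reflect (forall z w, (val z).2 = (val w).2 -> F z v = F w v) (snd_only v).
Proof.
apply: (iffP forallP) => h z.
  by move=> w /eqP zw; apply/eqP/(implyP (forallP (h z) w)).
by apply/forallP => w; apply/implyP => /eqP zw; apply/eqP/h.
Qed.

(** Any two pairs are joined by changing one coordinate at a time, through a common second
    coordinate [c]. *)
Lemma fixed_ptP v : reflect (forall z w, F z v = F w v) (fixed_pt v).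
Proof.
apply: (iffP andP) => [[/fst_onlyP h1 /snd_onlyP h2] z w | h]; last first.
  by split; [apply/fst_onlyP | apply/snd_onlyP] => z w _.
have [|c] := @exists_notin T [:: (val z).1; (val w).1].
  exact: leq_trans T6.
rewrite !inE negb_or => /andP[]; rewrite ![c == _]eq_sym => zc wc.
pose zc' : distinct_pair T := exist _ ((val z).1, c) zc.
pose wc' : distinct_pair T := exist _ ((val w).1, c) wc.
by rewrite (h1 z zc') // (h2 zc' wc') // (h1 wc' w).
Qed.

(** Triple transitivity carries one coincidence to all pairs with equal first coordinates. *)
Lemma fst_only_intro v z w :
  (val z).1 = (val w).1 -> (val z).2 != (val w).2 -> F z v = F w v ->
  fst_only v.
Proof.
move=> zw1 zw2 Fzw; apply/fst_onlyP => z' w' zw1'.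
have [zw2'|zw2'] := eqVneq (val z').2 (val w').2.
  suff -> : z' = w' by [].
  by apply: val_inj; case: (val z') (val w') zw1' zw2' => ? ? [? ?] /= -> ->.
have [|||s []] := @perm_extending T [:: (val z).1; (val z).2; (val w).2]
    [:: (val z').1; (val z').2; (val w').2].
- by rewrite /= !inE negb_or (valP z) zw2 zw1 (valP w).
- by rewrite /= !inE negb_or (valP z') zw2' zw1' (valP w').
- by [].
move=> s1 s2 s3; rewrite -(@pair_move s z z') // Fzw (@pair_move s w w') //.
by rewrite -zw1 s1.
Qed.

Lemma snd_only_intro v z w :
  (val z).2 = (val w).2 -> (val z).1 != (val w).1 -> F z v = F w v ->
  snd_only v.
Proof.
move=> zw2 zw1 Fzw; apply/snd_onlyP => z' w' zw2'.
have [zw1'|zw1'] := eqVneq (val z').1 (val w').1.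
  suff -> : z' = w' by [].
  by apply: val_inj; case: (val z') (val w') zw1' zw2' => ? ? [? ?] /= -> ->.
have [|||s []] := @perm_extending T [:: (val z).1; (val w).1; (val z).2]
    [:: (val z').1; (val w').1; (val z').2].
- by rewrite /= !inE negb_or (valP z) zw1 zw2 (valP w).
- by rewrite /= !inE negb_or (valP z') zw1' zw2' (valP w').
- by [].
move=> s1 s2 s3; rewrite -(@pair_move s z z') // Fzw (@pair_move s w w') //.
by rewrite -zw2 s3.
Qed.

(** By transitivity the coincidence spreads to all disjoint pairs; with six elements, any two pairs
    are both disjoint from some third pair [k]. *)
Lemma fixed_pt_intro v z w :
  uniq [:: (val z).1; (val z).2; (val w).1; (val w).2] -> F z v = F w v ->
  fixed_pt v.
Proof.
move=> uzw Fzw; apply/fixed_ptP => z' w'.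
pose l := [:: (val z').1; (val z').2; (val w').1; (val w').2].
have [|c cl] := @exists_notin T l; first exact: leq_trans T6.
have [|d dl] := @exists_notin T (c :: l); first exact: T6.
have dc : d != c by move: dl; rewrite inE negb_or => /andP[].
pose k : distinct_pair T := exist _ (d, c) dc.
suff Fk i : {subset [:: (val i).1; (val i).2] <= l} -> F i v = F k v.
  by rewrite !Fk // => j; rewrite !inE => /orP[] ->; rewrite ?orbT.
move=> il; have [|||s []] := @perm_extending T
  [:: (val z).1; (val z).2; (val w).1; (val w).2]
  [:: (val i).1; (val i).2; d; c] => //.
  have /il i1 : (val i).1 \in [:: (val i).1; (val i).2] by rewrite mem_head.
  have /il i2 : (val i).2 \in [:: (val i).1; (val i).2].
    by rewrite !inE eqxx orbT.
  have notl j j' : j \in l -> j' \notin l -> j != j'.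
    by move=> jl; apply: contraNneq => <-.
  have dl' : d \notin l by apply: contra dl; rewrite inE orbC => ->.
  rewrite /= !inE !negb_or (valP i) dc (notl _ _ i1 cl) (notl _ _ i2 cl).
  by rewrite (notl _ _ i1 dl') (notl _ _ i2 dl').
move=> s1 s2 s3 s4; rewrite -(@pair_move s z i) //.
rewrite Fzw.
rewrite (@pair_move s w k) //.
Qed.

(** Different second coordinates would put the coincidence under [fst_only_intro] or
    [fixed_pt_intro]. The two inequalities hold automatically for pairs from [A * B] with [A], [B]
    disjoint. *)
Lemma not_fst_only_inj v z w :
  ~~ fst_only v -> (val z).1 != (val w).2 -> (val z).2 != (val w).1 ->
  F z v = F w v -> (val z).2 = (val w).2.
Proof.
move=> v1 zw12 zw21 Fzw; apply: contraNeq v1 => zw2.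
have [zw1|zw1] := eqVneq (val z).1 (val w).1; first exact: fst_only_intro Fzw.
suff /andP[] : fixed_pt v by [].
apply: fixed_pt_intro Fzw.
by rewrite /= !inE !negb_or (valP z) (valP w) zw1 zw12 zw21 zw2.
Qed.

Lemma not_snd_only_inj v z w :
  ~~ snd_only v -> (val z).1 != (val w).2 -> (val z).2 != (val w).1 ->
  F z v = F w v -> (val z).1 = (val w).1.
Proof.
move=> v2 zw12 zw21 Fzw; apply: contraNeq v2 => zw1.
have [zw2|zw2] := eqVneq (val z).2 (val w).2; first exact: snd_only_intro Fzw.
suff /andP[] : fixed_pt v by [].
apply: fixed_pt_intro Fzw.
by rewrite /= !inE !negb_or (valP z) (valP w) zw1 zw12 zw21 zw2.
Qed.

Lemma fst_only_L x v : fst_only (L x v).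
Proof.
apply/fst_onlyP => z w; rewrite [F z _]phi_comp [F w _]phi_comp => zw.
by rewrite /mul /= zw.
Qed.

Lemma snd_only_R x v : snd_only (R x v).
Proof.
apply/snd_onlyP => z w; rewrite [F z _]phi_comp [F w _]phi_comp => zw.
by rewrite /mul /= zw.
Qed.

(** * Connecting the two kinds of vertices inside the image of [F z] *)

Section Retract.
Variable z : distinct_pair T.
Local Notation p := (F z).

Lemma fst_only_retract v : fst_only (p v) = fst_only v.
Proof. by apply/fst_onlyP/fst_onlyP => h z' w' /h; rewrite !pair_retract. Qed.

Lemma snd_only_retract v : snd_only (p v) = snd_only v.
Proof. by apply/snd_onlyP/snd_onlyP => h z' w' /h; rewrite !pair_retract. Qed.

Lemma fixed_pt_retract v : fixed_pt (p v) = fixed_pt v.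
Proof. by rewrite /fixed_pt fst_only_retract snd_only_retract. Qed.

Definition moved_edge : rel G := fun u v =>
  [&& edge u v, ~~ fixed_pt u, ~~ fixed_pt v, p u == u & p v == v].

(* Write [z = (x, y)]. If no such path exists, [F (x, y)] on the part reached
   from the [fst_only] vertices glues with [F (y, x)] elsewhere to an
   endomorphism [m] such that [m \o L x = L x] and [m \o R y = R x]. On [T + T],
   [m] would send [inl x] to [inl x] and [inr y] to [inr x], which no element of
   the monoid does, as [x != y]. *)
Lemma connected_fst_snd : exists u (w : G),
  [/\ fst_only u /\ snd_only w, ~~ fixed_pt u /\ ~~ fixed_pt w,
      p u = u & connect moved_edge u w].
Proof.
pose start u := [&& fst_only u, ~~ fixed_pt u & p u == u].
have [/existsP[u /existsP[w /and4P[/and3P[u1 uN /eqP pu] w2 wN uw]]]|none] :=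
  boolP [exists u, exists w : G,
    [&& start u, snd_only w, ~~ fixed_pt w & connect moved_edge u w]].
  by exists u, w.
pose z' : distinct_pair T := move_pair (tperm (val z).1 (val z).2) z.
(* Testing [p v] instead of [v] extends the component to all of [G]. *)
pose C v := [exists u, start u && connect moved_edge u (p v)].
pose f := [ffun v => if C v then F z v else F z' v].
have f_hom : is_hom f.
  apply/is_homP => u v uv; rewrite !ffunE.
  (* At fixed points both pieces agree, so only edges between non-fixed vertices matter; [p] maps
     these to [moved_edge], whence [C] is constant along them. *)
  have F_pt t : fixed_pt t -> F z' t = F z t by move=> /fixed_ptP.
  have [uP|uP] := boolP (fixed_pt u).
    rewrite (F_pt u) // if_same.
    by case: ifP => _; [|rewrite -(F_pt u)]; rewrite //= endo_edge.
  have [vP|vP] := boolP (fixed_pt v).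
    rewrite (F_pt v) // if_same.
    by case: ifP => _; [|rewrite -(F_pt v)]; rewrite ?endo_edge.
  have C_step a b : edge a b -> ~~ fixed_pt a -> ~~ fixed_pt b -> C a -> C b.
    move=> ab aP bP /existsP[c /andP[sc ca]]; apply/existsP; exists c.
    rewrite sc; apply: connect_trans ca (connect1 _).
    rewrite /moved_edge endo_edge // !fixed_pt_retract aP bP.
    by rewrite !pair_retract !eqxx.
  have -> : C u = C v.
    by apply/idP/idP; apply: C_step => //; rewrite edge_sym.
  by case: ifP; rewrite endo_edge.
have [m mf] := phi_surj (Endo f_hom).
have mE v : phi m v = if C v then F z v else F z' v by rewrite mf ffunE.
have FL (w : distinct_pair T) v : F w (L (val z).1 v) = L (val w).1 v.
  exact: phi_comp.
have FR w v : F w (R (val z).2 v) = R (val w).2 v by apply: phi_comp.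
have mL : (m * inr (inl (val z).1))%g = inr (inl (val z).1).
  apply: phiI; apply/val_inj/ffunP => v.
  rewrite -phi_comp mE; case: ifP => [_|/negbT notC]; first exact: FL.
  have [/fixed_ptP cL|LP] := boolP (fixed_pt (L (val z).1 v)).
    by rewrite (cL _ z) FL.
  case/negP: notC; apply/existsP; exists (p (L (val z).1 v)).
  rewrite connect0 andbT /start fixed_pt_retract LP fst_only_retract.
  by rewrite fst_only_L pair_retract eqxx.
have mR : (m * inr (inr (val z).2))%g = inr (inr (val z).1).
  have z'2 : (val z').2 = (val z).1 by rewrite /= tpermR.
  apply: phiI; apply/val_inj/ffunP => v.
  rewrite -phi_comp mE; case: ifP => [/existsP[u /andP[su uR]]|_]; last first.
    by rewrite [LHS]FR z'2.
  have [/fixed_ptP cR|RP] := boolP (fixed_pt (R (val z).2 v)).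
    by rewrite (cR _ z') [LHS]FR z'2.
  case/negP: none; apply/existsP; exists u.
  apply/existsP; exists (p (R (val z).2 v)).
  by rewrite su uR fixed_pt_retract RP snd_only_retract snd_only_R.
case: m {mf mE} mL mR => [[s|w]|c] [mL] [mR].
- by case/negP: (valP z); apply/eqP/(@perm_inj _ s); rewrite mL mR.
- by case/negP: (valP w); rewrite mL mR.
- by move: mL mR; rewrite /= => -> [].
Qed.

Lemma moved_path : exists u s (w : G),
  [/\ path (@edge G) u (rcons s w), uniq (u :: rcons s w),
      [/\ fst_only u, ~~ snd_only u, snd_only w & ~~ fst_only w],
      {in u :: rcons s w, forall q, p q = q} &
      {in s, forall q, ~~ fst_only q /\ ~~ snd_only q}].
Proof.
have [u [w [[u1 w2] [uP wP] pu /connectP[s e_s sw]]]] := connected_fst_snd.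
case: (shortenP e_s) sw => {e_s} s' es' us' _ ws'.
case/lastP: s' => [|s' w'] in es' us' ws' *.
  by case/negP: wP; rewrite /fixed_pt w2 ws' u1.
rewrite last_rcons in ws'; subst w'.
(* Carried through the shortening, so that the new ends are again non-fixed and in the image of
   [p]. *)
pose C q := ~~ fixed_pt q && (p q == q).
have Cs : all C (u :: rcons s' w).
  rewrite /= {1}/C uP pu eqxx /=.
  elim: (rcons s' w) u {us' u1 uP pu} es' => //=.
  move=> b r IHr a /andP[/and5P[_ _ bP _ bp] /IHr ->].
  by rewrite /C bP bp.
have ed : path (@edge G) u (rcons s' w).
  by apply: sub_path es' => a b /andP[].
have [x [r [y [pxy uxy [x1 y2] Cxy ab]]]] :=
  path_between_avoiding ed us' u1 w2 Cs.
have /andP[/andP[xP _] /allP Cry] := Cxy.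
have /andP[yP _] : C y by apply: Cry; rewrite mem_rcons mem_head.
exists x, r, y; split=> //.
- split=> //; first by apply: contra xP => x2; apply/andP.
  by apply: contra yP => y1; apply/andP.
- by move=> q /(allP Cxy)/andP[_ /eqP].
- by move=> q /(allP ab); rewrite /= negb_or => /andP.
Qed.

End Retract.
End Representation.

(** * Assembling the subdivision of [H] *)

Lemma subdivision_of_representation (H G : graph)
    (phi : pair_monoid (H + H * H + 'I_6)%type -> End G) :
  {morph phi : m m' / (m * m')%g} -> injective phi ->
  (forall f, exists m, phi m = f) -> contains_subdivision H G.
Proof.
set T : finType := (H + H * H + 'I_6)%type; move=> phiM phiI phi_surj.
pose F z := phi (inl (inr z)).
(* Separate summands keep first and second coordinates disjoint; ['I_6] ensures six elements and
   hosts the base pair [z0]. *)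
pose pr (a : H) (e : H * H) : distinct_pair T :=
  exist _ (inl (inl a), inl (inr e)) isT.
pose z0 : distinct_pair T := exist _ (inr ord0, inr ord_max) isT.
have T6 : 5 < #|T| by rewrite !card_sum card_ord leq_addl.
have [q0 [s [y [pq uq [q1 q2 y2 y1] fixq s12]]]] :=
  moved_path phiM phiI phi_surj T6 z0.
(* [F z0] undoes every [F z] on the base path, so different positions never collide. *)
have F_inj z w : {in q0 :: rcons s y &, forall q r, F z q = F w r -> q = r}.
  move=> q r qs rs /(congr1 (F z0)).
  by rewrite !(pair_retract phiM) !fixq.
have sq q : q \in s -> q \in q0 :: rcons s y.
  by move=> qs; rewrite inE mem_rcons inE qs !orbT.
have yq : y \in q0 :: rcons s y by rewrite inE mem_rcons mem_head orbT.
have hub a e e' : F (pr a e) q0 = F (pr a e') q0 by apply: (fst_onlyP _ _ q1).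
have mid a b e : F (pr a e) y = F (pr b e) y by apply: (snd_onlyP _ _ y2).
have snd_eq q a b e e' :
    q \in rcons s y -> F (pr a e) q = F (pr b e') q -> e = e'.
  rewrite mem_rcons inE => /predU1P qs Fab.
  have nq : ~~ fst_only phi q by case: qs => [->|/s12[]].
  have := @not_fst_only_inj _ _ _ phiM T6 q (pr a e) (pr b e') nq.
  by move/(_ isT isT Fab) => -[].
have fst_eq q a b e e' :
    q \in q0 :: s -> F (pr a e) q = F (pr b e') q -> a = b.
  rewrite inE => /predU1P qs Fab.
  have nq : ~~ snd_only phi q by case: qs => [->|/s12[]].
  have := @not_snd_only_inj _ _ _ phiM T6 q (pr a e) (pr b e') nq.
  by move/(_ isT isT Fab) => -[].
(* Two images of the base path, from the hubs [e.1] and [e.2], glued at the image of [y], which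
   depends on [e] only. *)
pose S (e : H * H) := [seq F (pr e.1 e) q | q <- s] ++
  F (pr e.1 e) y :: rev [seq F (pr e.2 e) q | q <- s].
pose E := [seq e <- enum {: H * H} | edge e.1 e.2].
have S_in e v : v \in S e ->
    exists a q, q \in rcons s y /\ v = F (pr a e) q.
  rewrite mem_cat inE mem_rev => /or3P[/mapP[q qs ->]|/eqP->|/mapP[q qs ->]].
  - by exists e.1, q; rewrite mem_rcons inE qs orbT.
  - by exists e.1, y; rewrite mem_rcons mem_head.
  - by exists e.2, q; rewrite mem_rcons inE qs orbT.
have rq q : q \in rcons s y -> q \in q0 :: rcons s y.
  by move=> qs; rewrite inE qs orbT.
have /and3P[q0N yN us] : [&& q0 \notin rcons s y, y \notin s & uniq s].
  by move: uq; rewrite /= rcons_uniq.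
pose L := [seq (e.1, e.2, S e) | e <- E].
have LS : [seq t.2 | t <- L] = map S E by rewrite -map_comp.
(* The second coordinate [(a, a)] is arbitrary, as [q0] is [fst_only]. *)
apply: (@path_system_subdivision H G H (fun a => F (pr a (a, a)) q0) L).
- exact: subdivision_refl.
- by move=> a b /fst_eq; apply; rewrite mem_head.
- rewrite LS; apply: uniq_flatten_map; first exact/filter_uniq/enum_uniq.
    move=> e; rewrite mem_filter => /andP[e12 _].
    have uF a : uniq [seq F (pr a e) q | q <- s].
      by rewrite map_inj_in_uniq // => q r /sq qs /sq rs; apply: F_inj.
    rewrite cat_uniq uF cons_uniq mem_rev rev_uniq uF andbT /=.
    have yNF a b : F (pr a e) y \notin [seq F (pr b e) q | q <- s].
      apply/mapP => -[q qs Fyq]; case/negP: yN.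
      by rewrite (F_inj _ _ _ _ yq (sq _ qs) Fyq).
    rewrite yNF negb_or yNF andbT; apply/hasPn => v.
    rewrite mem_rev => /mapP[q qs ->]; apply/mapP => -[r rs qr].
    have qr' := F_inj _ _ _ _ (sq _ qs) (sq _ rs) qr.
    rewrite -qr' in qr.
    (* The two halves could only meet if [e] were a loop. *)
    have e21 : e.2 = e.1 by apply: fst_eq qr; rewrite inE qs orbT.
    by rewrite e21 edge_irr in e12.
  move=> e e' v _ _ /S_in[a [q [qs ->]]] /S_in[b [r [rs qr]]].
  have qr' := F_inj _ _ _ _ (rq _ qs) (rq _ rs) qr.
  by rewrite -qr' in qr; apply: snd_eq qr.
- move=> a; rewrite LS; apply/flatten_mapP => -[e _ /S_in[b [q [qs qr]]]].
  have q0q := F_inj _ _ _ _ (mem_head _ _) (rq _ qs) qr.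
  by rewrite q0q qs in q0N.
- move=> _ /mapP[e _ ->] /=.
  have pF a :
      path (@edge G) (F (pr a e) q0) [seq F (pr a e) q | q <- rcons s y].
    by apply: homo_path pq => u v; apply: endo_edge.
  rewrite (hub _ _ e) (hub e.2 _ e) rcons_cat rcons_cons -cat_rcons cat_path.
  rewrite -map_rcons pF /= map_rcons last_rcons (mid _ e.2) -rev_cons.
  have := rev_path (@edge G) (F (pr e.2 e) q0)
    [seq F (pr e.2 e) q | q <- rcons s y].
  rewrite map_rcons last_rcons belast_rcons => ->.
  rewrite -map_rcons; apply: sub_path (pF e.2) => u v.
  by rewrite edge_sym.
- move=> a b ab; right; exists (S (a, b)); left.
  by apply/mapP; exists (a, b); rewrite // mem_filter ab mem_enum.
Qed.

Lemma completely_regular_forcing_subdivision (H : graph) :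
  exists M : finMonoidType, completely_regular M /\
    forall G : graph, monoid_isomorphic (End G) M -> contains_subdivision H G.
Proof.
exists (pair_monoid (H + H * H + 'I_6)%type).
split=> [|G [f [g fK gK] [f1 fM]]]; first exact: pair_monoid_completely_regular.
apply: (@subdivision_of_representation H G g).
- by move=> m m'; apply: (can_inj fK); rewrite gK fM !gK.
- exact: can_inj gK.
- by move=> h; exists (f h).
Qed.

Theorem theorem4 :
  (forall n : nat, 0 < n ->
     exists M : finMonoidType,
       completely_regular M /\
       forall G : graph, monoid_isomorphic (End G) M ->
         contains_subdivision (biclique n n) G) /\
  (forall C : graph -> Prop,
     excludes_topological_minor C -> ~ End_universal C completely_regular).
Proof.
split=> [n _|C [H exclH] univC].
  exact: completely_regular_forcing_subdivision.
have [M [regM subM]] := completely_regular_forcing_subdivision H.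
have [G CG [f [g fK gK] [f1 fM]]] := univC M regM.
apply: (exclH G CG); apply: subM; exists g; first by exists f.
split; first by rewrite -f1 fK.
by move=> m m'; apply: (can_inj fK); rewrite gK fM !gK.
Qed.
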